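(* For all integers $0\leq t\leq k$, $d\geq 2k$, and $n\geq 2k+1$, $$\alpha_d^t(\mathcal{G}_{n,k})\;\geq\;\left(\frac{d-2k+1}{d-\frac{3}{2}k+1+\frac{t(t+1)}{2(k+1)}}\right)\left(\frac{t+1}{k+1}\right)n\;+\;\frac{k(t+1)}{d-\frac{3}{2}k+1+\frac{t(t+1)}{2(k+1)}}.$$
   Context: All graphs are finite, undirected, and simple. The treewidth of a graph $G$ is the minimum integer $k$ such that $G$ is a subgraph of a chordal graph with no clique on more than $k+1$ vertices. $\mathcal{G}_{n,k}$ denotes the family of $n$-vertex graphs with treewidth $k$. For a graph $G$ and integers $t,d\geq 0$, $\alpha_d^t(G)$ denotes the maximum cardinality of a set $S\subseteq V(G)$ such that every vertex of $S$ has degree at most $d$ in $G$ and the induced subgraph $G[S]$ has treewidth at most $t$ (the empty set is allowed as $S$). For a family $\mathcal{G}$ of graphs, $\alpha_d^t(\mathcal{G})$ is the minimum of $\alpha_d^t(G)$ over all $G\in\mathcal{G}$. *)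

(* Defs.v *)
From HB Require Import structures.
From mathcomp Require Import all_boot all_order all_algebra.
From mathcomp Require Import boolp classical_sets.

Set Implicit Arguments.
Unset Strict Implicit.
Unset Printing Implicit Defensive.

(* The minimum of a set of natural numbers; 0 by convention on the empty set. *)
Definition least (A : nat -> Prop) : nat :=
  xget 0 (fun m => A m /\ forall j, A j -> m <= j).

Lemma leastP (A : nat -> Prop) (m : nat) :
  A m -> A (least A) /\ forall j, A j -> least A <= j.
Proof.
move=> Am; pose P := fun m => A m /\ forall j, A j -> m <= j.
have exA : exists m, `[< A m >] by exists m; apply/asboolP.
apply: (@xgetPex _ 0 P); exists (ex_minn exA).
case: ex_minnP => i /asboolP Ai lei; split=> // j Aj.
by apply: lei; apply/asboolP.
Qed.

Record sgraph := SGraph {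
  vertex :> finType;
  adj : rel vertex;
  adj_sym : symmetric adj;
  adj_irr : irreflexive adj }.

Arguments adj {s} : rename.

Definition degree (G : sgraph) (v : G) : nat := #|[set u | adj v u]|.

Section Induced.
Variables (G : sgraph) (S : {set G}).

Definition induced_adj : rel {x : G | x \in S} :=
  fun x y => adj (val x) (val y).

Lemma induced_sym : symmetric induced_adj.
Proof. by move=> x y; apply: adj_sym. Qed.

Lemma induced_irr : irreflexive induced_adj.
Proof. by move=> x; apply: adj_irr. Qed.

Definition induced : sgraph := SGraph induced_sym induced_irr.
End Induced.

(* Not necessarily induced and not necessarily spanning: H may have more
   vertices than G. *)
Definition subgraph (G H : sgraph) : Prop :=
  exists2 f : G -> H, injective f & forall x y, adj x y -> adj (f x) (f y).

Definition clique (G : sgraph) (K : {set G}) : Prop :=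
  {in K &, forall x y, x != y -> adj x y}.

(* Every cycle on at least four vertices has a chord: an edge joining two
   vertices that are not consecutive on the cycle. *)
Definition chordal (G : sgraph) : Prop :=
  forall c : seq G, 4 <= size c -> ucycle adj c ->
  exists x y : G, [/\ x \in c, y \in c, adj x y, y != next c x
                    & x != next c y].

(* The minimum ranges over the naturals, so the graph without vertices gets
   treewidth 0 rather than -1; this is harmless for "treewidth at most t" with
   t >= 0. The minimum is over a nonempty set, as every G is a subgraph of the
   complete graph on its own vertices. *)
Definition treewidth (G : sgraph) : nat :=
  least (fun k => exists H : sgraph,
    [/\ chordal H, subgraph G H & forall K : {set H}, clique K -> #|K| <= k.+1]).

Definition tw_family (n k : nat) (G : sgraph) : Prop :=
  #|G| = n /\ treewidth G = k.

(* S = set0 always qualifies, so this is a maximum over a nonempty set. *)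
Definition alpha (t d : nat) (G : sgraph) : nat :=
  \max_(S : {set G} | [forall v in S, degree v <= d]
                      && (treewidth (induced S) <= t)) #|S|.

Definition alpha_family (t d : nat) (F : sgraph -> Prop) : nat :=
  least (fun m => exists2 G, F G & alpha t d G = m).

(* Main.v *)
Require Import Defs.
From mathcomp Require Import all_boot all_order all_algebra.
From mathcomp Require Import zify ring lra.

(* By Dirac's theorem on simplicial vertices, a graph of treewidth at most [k]
   on more than [k] vertices is a spanning subgraph of a [k]-tree, and every
   vertex set admissible for the [k]-tree is admissible for the graph. A [k]-tree on [n] vertices has degree sum
   [2kn - k(k+1)]. Let [L] be the set of vertices of degree at most [d] and, for
   [j < k], let [V_j] be the set of vertices of degree at most [k + j]. If
   [n > 2k], then every clique on [m <= k + 1] vertices contains a vertex of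
   degree at least [k + m - 1], so [V_j] contains no clique on [j + 2] vertices.
   Thus [V_j] is (j+1)-colourable; the union of its [min (t, j) + 1] heaviest
   colour classes induces a chordal graph of treewidth at most [t], and in the
   same way [L] yields a set of at least [(t+1) |L| / (k+1)] vertices. The bound
   follows by adding up these estimates, with [L] taken [d + 1 - 2k] times: a
   vertex of degree [D <= d] is then counted at least [d + 1 - D] times, and the
   sum of [d + 1 - D] over all vertices is known. *)

Set Implicit Arguments.
Unset Strict Implicit.
Unset Printing Implicit Defensive.

(** * Selections from finite sets, and cycles *)

Lemma card_sandwich (T : finType) (C N : {set T}) m :
  C \subset N -> #|C| <= m -> m <= #|N| ->
  exists K : {set T}, [/\ C \subset K, K \subset N & #|K| = m].
Proof.
move=> CN; elim: m => [|m IH] Cm mN.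
  by exists C; split=> //; apply/eqP; rewrite -leqn0.
move: Cm; rewrite leq_eqVlt => /orP[/eqP eqC|Cm]; first by exists C.
have [K [CK KN cK]] := IH Cm (ltnW mN).
have /card_gt0P[x] : 0 < #|N :\: K|.
  by rewrite cardsD (setIidPr KN) cK subn_gt0.
rewrite inE => /andP[xK xN]; exists (x |: K); split.
- by apply: subset_trans CK (subsetU1 _ _).
- by rewrite subUset sub1set xN.
- by rewrite cardsU1 xK cK.
Qed.

(** Indices are removed one at a time, each of least weight among those left, so the average weight
    never decreases. *)
Lemma heavy_subset (I : finType) (w : I -> nat) s :
  s <= #|I| ->
  exists2 J : {set I}, #|J| = s & s * \sum_i w i <= #|I| * \sum_(i in J) w i.
Proof.
move=> sI; have: #|I| - s <= #|I| by apply: leq_subr.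
move: sI => /subKn; move: (#|I| - s) => r <-{s}.
elim: r => [|r IH] rI.
  by exists setT; rewrite ?subn0 ?cardsT //; under [in leqRHS]eq_bigl do rewrite inE.
have [J cJ wJ] := IH (ltnW rI).
have [i0 Ji0] : exists i, i \in J by apply/card_gt0P; rewrite cJ; lia.
have [i Ji wi] : exists2 i, i \in J & forall j, j \in J -> w i <= w j.
  by case: (@arg_minnP _ i0 (mem J) w Ji0) => i; exists i.
exists (J :\ i); first by have := cardsD1 i J; rewrite Ji cJ; lia.
move: wJ; rewrite (big_setD1 i) //=.
have: #|J :\ i| * w i <= \sum_(j in J :\ i) w j.
  by rewrite -sum_nat_const; apply: leq_sum => j; rewrite !inE => /andP[_ /wi].
have -> : #|J :\ i| = #|I| - r.+1 by have := cardsD1 i J; rewrite Ji cJ; lia.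
set W := \sum_i0 _; set S := \sum_(_ in _) _; set m := #|I| - r.+1.
have -> : #|I| - r = m.+1 by rewrite /m; lia.
have mI : m <= #|I| by exact: leq_subr.
move: (#|I|) mI => M mI; move: (w i) => x; move: W S m mI => W S m mI h1 h2.
nia.
Qed.

(** Serves to show that the two neighbours of a vertex on a cycle are distinct and not consecutive,
    so that an edge between them is a chord. *)
Lemma iter_next_neq (T : eqType) (c : seq T) x :
  4 <= size c -> uniq c -> x \in c ->
  [/\ next c x != x, next c (next c x) != x &
      next c (next c (next c x)) != x].
Proof.
move=> sc uc xc; have [i s Es] := rot_to xc.
have : uniq (rot i c) by rewrite rot_uniq.
have : 4 <= size (rot i c) by rewrite size_rot.
rewrite -!(next_rot i uc) Es.
case: s {Es} => [|a [|b [|z s]]] //= _.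
rewrite !inE !negb_or !eqxx /=.
case/andP=> /and4P[xa xb xz _] /andP[/and3P[ab az _] _].
have F (y w : T) : y != w -> (w == y) = false by rewrite eq_sym => /negPf.
by rewrite (F _ _ xa) (F _ _ xb) (F _ _ ab) eqxx (F _ _ xz).
Qed.

Lemma chord_of_neighbours (G : sgraph) (c : seq G) x : 4 <= size c -> ucycle adj c ->
  x \in c -> adj (next c x) (prev c x) ->
  exists x y : G, [/\ x \in c, y \in c, adj x y, y != next c x
                    & x != next c y].
Proof.
move=> sc /andP[_ uc] xc axy; have [nx _ n3x] := iter_next_neq sc uc xc.
exists (next c x), (prev c x); rewrite mem_next mem_prev next_prev //.
split=> //; apply: contraNneq n3x => E.
by rewrite -E next_prev.
Qed.

(** * k-trees *)

Section Cliques.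
Variables (T : finType) (e : rel T).

(** Stated for a bare relation, so that a graph and a [k]-tree containing it can share one vertex
    type. *)
Definition rel_clique (K : {set T}) : Prop :=
  {in K &, forall x y, x != y -> e x y}.

Definition nbrs (A : {set T}) (v : T) : {set T} := [set u in A | e v u].

Lemma sub_rel_clique (K K' : {set T}) :
  K \subset K' -> rel_clique K' -> rel_clique K.
Proof. by move=> /subsetP s cK x y /s xK /s yK; apply: cK. Qed.

Lemma rel_clique_nbrs (A K : {set T}) v : rel_clique K -> K \subset v |: A -> v \in K ->
  K :\ v \subset nbrs A v.
Proof.
move=> cK /subsetP KA vK; apply/subsetP => u; rewrite !inE => /andP[uv uK].
have := KA u uK; rewrite !inE (negPf uv) /= => ->.
by apply: cK; rewrite // eq_sym.
Qed.

(* [ktree k A]: the subgraph that [e] induces on [A] is a [k]-tree. *)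
Inductive ktree (k : nat) : {set T} -> Prop :=
| ktree_base (A : {set T}) : #|A| = k.+1 -> rel_clique A -> ktree k A
| ktree_step (A : {set T}) v : ktree k A -> v \notin A -> rel_clique (nbrs A v) ->
    #|nbrs A v| = k -> ktree k (v |: A).

Lemma ktree_card k (A : {set T}) : ktree k A -> k < #|A|.
Proof.
elim=> [B ->//|B v _ kB vB _ _]; rewrite cardsU1 vB; exact: leq_trans kB _.
Qed.

(** A clique through the last vertex added has its other vertices among the [k] neighbours of that
    vertex. *)
Lemma ktree_clique_card k (A : {set T}) : ktree k A ->
  forall K : {set T}, K \subset A -> rel_clique K -> #|K| <= k.+1.
Proof.
elim=> [B cB _|B v _ IH vB _ cN] K KB cK; first by rewrite -cB subset_leq_card.
have [vK|vK] := boolP (v \in K).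
  rewrite (cardsD1 v) vK add1n ltnS -cN subset_leq_card //.
  exact: rel_clique_nbrs.
apply: IH cK; apply/subsetP => u uK; have := subsetP KB u uK.
by rewrite !inE => /orP[/eqP E|//]; rewrite -E uK in vK.
Qed.

Lemma subsetU1_notin (v : T) (A C : {set T}) :
  C \subset v |: A -> v \notin C -> C \subset A.
Proof.
move=> /subsetP CA vC; apply/subsetP => u uC; have := CA u uC.
by rewrite !inE => /orP[/eqP E|//]; rewrite -E uC in vC.
Qed.

Hypothesis e_sym : symmetric e.
Hypothesis e_irr : irreflexive e.

Lemma rel_cliqueU1 (K : {set T}) v : rel_clique K -> {in K, forall u, e v u} ->
  rel_clique (v |: K).
Proof.
move=> cK vK x y; rewrite !inE => /orP[/eqP->|xK] /orP[/eqP->|yK] xy.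
- by rewrite eqxx in xy.
- exact: vK.
- by rewrite e_sym; apply: vK.
- exact: cK.
Qed.

(** If [C] contains the newest vertex [v], the rest of [C] is filled up to [k - 1] vertices among
    the neighbours of [v]; otherwise induction applies. This lets a vertex with fewer than [k]
    neighbours be attached to a [k]-tree. *)
Lemma ktree_clique_extend k (A : {set T}) : ktree k A ->
  forall C : {set T}, C \subset A -> rel_clique C -> #|C| <= k ->
  exists K : {set T}, [/\ C \subset K, K \subset A, rel_clique K & #|K| = k].
Proof.
elim=> [B cB clB|B v tB IH vB clN cN] C CB clC cC.
  have kB : k <= #|B| by rewrite cB.
  have [K [CK KB cK]] := card_sandwich CB cC kB.
  by exists K; split=> //; apply: sub_rel_clique clB.
have [vC|vC] := boolP (v \in C); last first.
  have [K [CK KB clK cK]] := IH C (subsetU1_notin CB vC) clC cC.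
  by exists K; split=> //; apply: subset_trans KB (subsetU1 _ _).
have CN := rel_clique_nbrs clC CB vC.
have cC1 : #|C :\ v| <= k.-1 by have := cardsD1 v C; rewrite vC; lia.
have [|K [CK KN cK]] := card_sandwich CN cC1; first by rewrite cN leq_pred.
have k_gt0 : 0 < k by apply: leq_trans cC; apply/card_gt0P; exists v.
have vK : v \notin K.
  by apply: contra vB => /(subsetP KN); rewrite inE => /andP[].
exists (v |: K); split.
- by rewrite -(setD1K vC) setUS.
- by apply: setUS; apply: subset_trans KN _; apply/subsetP => u; rewrite inE => /andP[].
- apply: rel_cliqueU1; first exact: sub_rel_clique clN.
  by move=> u /(subsetP KN); rewrite inE => /andP[].
- by rewrite cardsU1 vK cK; lia.
Qed.

Lemma card_nbrsU1 (A : {set T}) v u : v \notin A -> #|nbrs (v |: A) u| = e u v + #|nbrs A u|.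
Proof.
move=> vA; rewrite (cardsD1 v) inE setU11 /=; congr (_ + _).
apply: eq_card => w; rewrite !inE; have [->|//] := eqVneq w v.
by rewrite (negPf vA).
Qed.

(** Each new vertex adds [k] for itself and one for each of its [k] neighbours. *)
Lemma ktree_sum_degree k (A : {set T}) : ktree k A ->
  \sum_(v in A) #|nbrs A v| + k * k.+1 = 2 * k * #|A|.
Proof.
elim=> [B cB clB|B v tB IH vB clN cN].
  rewrite (eq_bigr (fun=> k)); first by rewrite sum_nat_const cB; lia.
  move=> v vB; have := cardsD1 v B; rewrite vB cB => -[->]; apply: eq_card => u.
  rewrite !inE [RHS]andbC; have [->|uv] := eqVneq u v; first by rewrite e_irr andbF.
  by apply: andb_id2l => uB; rewrite clB // eq_sym.
rewrite big_setU1 //= cardsU1 vB card_nbrsU1 // e_irr cN.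
rewrite (eq_bigr (fun u => (e u v : nat) + #|nbrs B u|)); last first.
  by move=> u uB; rewrite card_nbrsU1.
rewrite big_split /=.
have -> : \sum_(u in B) (e u v : nat) = k.
  rewrite -cN -sum1_card big_mkcond [RHS]big_mkcond /=; apply: eq_bigr => u _.
  by rewrite inE e_sym; case: (u \in B); case: (e v u).
by move: IH; rewrite !mulnDr; lia.
Qed.

(* If the new vertex lies outside of the clique [C] and the bound is attained,
   [C] contains two vertices that dominate [A]; one of them is a neighbour of
   the new vertex, as otherwise both together with the neighbours of the new
   vertex would form a clique on [k + 2] vertices. *)
Lemma ktree_clique_degree k (A : {set T}) : ktree k A ->
  forall C : {set T}, C \subset A -> rel_clique C -> 0 < #|C| -> k + #|C| <= #|A| ->
  exists2 q, q \in C & k + #|C| <= (#|nbrs A q|).+1.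
Proof.
elim=> [B cB clB|B v tB IH vB clN cN] C CB clC C_gt0 kC.
  have /card_gt0P[q qC] := C_gt0; exists q => //.
  have qB := subsetP CB q qC.
  have -> : nbrs B q = B :\ q.
    apply/setP => u; rewrite !inE andbC.
    have [->|uq] := eqVneq u q; first by rewrite e_irr.
    by apply: andb_id2r => uB; rewrite clB // eq_sym.
  by have := cardsD1 q B; rewrite qB; lia.
have cvB : #|v |: B| = (#|B|).+1 by rewrite cardsU1 vB.
have [vC|vC] := boolP (v \in C).
  have cC := cardsD1 v C; rewrite vC in cC.
  have [C0|C1] := posnP #|C :\ v|.
    by exists v => //; rewrite card_nbrsU1 // e_irr cN cC C0; lia.
  have CN := rel_clique_nbrs clC CB vC.
  have [||||q qC dq] := IH (C :\ v).
  - by apply: subset_trans CN _; apply/subsetP => u; rewrite inE => /andP[].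
  - exact: sub_rel_clique (subD1set _ _) clC.
  - by [].
  - by rewrite cvB in kC; lia.
  exists q; first by move: qC; rewrite inE => /andP[].
  have := subsetP CN q qC; rewrite inE e_sym => /andP[_ qv].
  by rewrite card_nbrsU1 // qv; lia.
have CB' := subsetU1_notin CB vC.
have [kCB|kCB] := leqP (k + #|C|) #|B|.
  have [q qC dq] := IH C CB' clC C_gt0 kCB; exists q => //.
  by rewrite card_nbrsU1 //; lia.
have kB := ktree_card tB.
(* Here [k + #|C| = #|B| + 1] and [C] has at least two vertices, so induction on [C] without [x]
   yields a vertex of degree [#|B| - 1] in [B]. *)
have dom (x : T) : x \in C -> exists q, [/\ q \in C, q != x &
    forall u, u \in B -> u != q -> e q u].
  move=> xC; have cC := cardsD1 x C; rewrite xC in cC.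
  have [||||q] := IH (C :\ x).
  - exact: subset_trans (subD1set _ _) CB'.
  - exact: sub_rel_clique (subD1set _ _) clC.
  - by lia.
  - by lia.
  rewrite inE => /andP[qx qC] dq; exists q; split=> [//||u uB uq].
    by move: qx; rewrite inE.
  have qB := subsetP CB' q qC.
  have E : nbrs B q = B :\ q.
    apply/eqP; rewrite eqEcard; apply/andP; split.
      apply/subsetP => w; rewrite !inE => /andP[wB qw]; rewrite wB andbT.
      by apply: contraTneq qw => ->; rewrite e_irr.
    by have := cardsD1 q B; rewrite qB; lia.
  have : u \in nbrs B q by rewrite E !inE uq.
  by rewrite inE => /andP[].
have /card_gt0P[x xC] := C_gt0.
have [q1 [q1C _ dom1]] := dom x xC.
have [q2 [q2C q21 dom2]] := dom q1 q1C.
have [q qC [domq vq]] : exists2 q, q \in C &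
    (forall u, u \in B -> u != q -> e q u) /\ e v q.
  have [v1|v1] := boolP (e v q1); first by exists q1.
  have [v2|v2] := boolP (e v q2); first by exists q2.
  have NB : nbrs B v \subset B by apply/subsetP => u; rewrite inE => /andP[].
  have n1 : q1 \notin nbrs B v by rewrite inE negb_and v1 orbT.
  have n2 : q2 \notin nbrs B v by rewrite inE negb_and v2 orbT.
  have cl : rel_clique (q2 |: (q1 |: nbrs B v)).
    apply: rel_cliqueU1; first apply: rel_cliqueU1 => //.
    - move=> u uN; apply: dom1; first exact: (subsetP NB).
      by apply: contraNneq n1 => <-.
    - move=> u; rewrite !inE => /orP[/eqP->|/andP[uB vu]].
        by rewrite dom2 // ?(subsetP CB') // eq_sym.
      by apply: dom2 => //; apply: contraNneq v2 => <-.
  have := ktree_clique_card tB (K := q2 |: (q1 |: nbrs B v)) _ cl.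
  rewrite cardsU1 cardsU1 n1 !inE negb_or q21 negb_and v2 orbT cN !add1n ltnn.
  by case/(_ _)/notF; rewrite !subUset !sub1set NB !(subsetP CB').
exists q => //; rewrite card_nbrsU1 // e_sym vq.
have qB := subsetP CB' q qC.
have -> : #|nbrs B q| = #|B :\ q|.
  apply: eq_card => u; rewrite !inE andbC.
  have [->|uq] := eqVneq u q; first by rewrite e_irr.
  by apply: andb_id2r => uB; rewrite domq.
by have := cardsD1 q B; rewrite qB; lia.
Qed.

(* Greedy colouring in the order of construction. *)
Lemma ktree_coloring k (A : {set T}) j (V : {set T}) : ktree k A ->
  (forall K : {set T}, K \subset V -> rel_clique K -> #|K| <= j.+1) ->
  exists f : T -> 'I_j.+1, {in A :&: V &, forall x y, e x y -> f x != f y}.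
Proof.
move=> tA VK.
(* The neighbours of [v] in [V] form with [v] a clique inside [V], so there are at most [j] of them
   and one of the [j + 1] colours is free. *)
have ext (B : {set T}) v (f : T -> 'I_j.+1) : v \in V -> v \notin B ->
    rel_clique (nbrs B v) ->
    {in B :&: V &, forall x y, e x y -> f x != f y} ->
  exists f : T -> 'I_j.+1, {in (v |: B) :&: V &, forall x y, e x y -> f x != f y}.
  move=> vV vB clN fP.
  have cN : #|nbrs B v :&: V| <= j.
    have vN : v \notin nbrs B v :&: V by rewrite !inE (negPf vB).
    have := VK (v |: nbrs B v :&: V); rewrite cardsU1 vN; apply.
      by rewrite subUset sub1set vV subsetIr.
    apply: rel_cliqueU1; first exact: sub_rel_clique (subsetIl _ _) clN.
    by move=> u; rewrite !inE => /andP[/andP[]].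
  have /card_gt0P[c] : 0 < #|~: (f @: (nbrs B v :&: V))|.
    rewrite cardsCs setCK card_ord subn_gt0 ltnS.
    exact: leq_trans (leq_imset_card _ _) cN.
  rewrite inE => fc; exists (fun x => if x == v then c else f x) => x y.
  have free u : u \in B -> u \in V -> e v u -> f u != c.
    move=> uB uV vu; apply: contraNneq fc => <-; apply: imset_f.
    by rewrite !inE uB vu.
  rewrite !inE; have [->|xv] := eqVneq x v; have [->|yv] := eqVneq y v.
  - by rewrite e_irr.
  - by move=> _ /andP[yB yV] vy; rewrite eq_sym free.
  - by move=> /andP[xB xV] _; rewrite e_sym; apply: free.
  - by move=> /= xBV yBV; apply: fP; rewrite inE.
elim: tA => [B cB clB|B v tB [f fP] vB clN cN]; last first.
  have [vV|vV] := boolP (v \in V); first exact: ext fP.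
  exists f => x y; rewrite !inE => /andP[/orP[/eqP->|xB] xV].
    by rewrite xV in vV.
  move=> /andP[/orP[/eqP->|yB] yV]; first by rewrite yV in vV.
  by apply: fP; rewrite inE ?xB ?yB.
(* The base clique is also coloured vertex by vertex with [ext], by induction on its size. *)
clear k cB; elim: {B}#|B| {-2}B (erefl #|B|) clB => [|m IH] B cB clB.
  by exists (fun=> ord0) => x y; rewrite (cards0_eq cB) !inE.
have /card_gt0P[v vB] : 0 < #|B| by rewrite cB.
have [f fP] : exists f : T -> 'I_j.+1,
    {in (B :\ v) :&: V &, forall x y, e x y -> f x != f y}.
  apply: IH; last exact: sub_rel_clique (subD1set _ _) clB.
  by have := cardsD1 v B; rewrite vB cB => -[].
have [vV|vV] := boolP (v \in V).
  rewrite -(setD1K vB); apply: ext fP; rewrite ?setD11 //.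
  apply: sub_rel_clique clB; apply/subsetP => u.
  by rewrite !inE => /andP[/andP[]].
exists f => x y; rewrite !inE => /andP[xB xV] /andP[yB yV].
have F z : z \in V -> z != v by apply: contraTneq => ->.
by apply: fP; rewrite !inE ?xB ?yB ?F.
Qed.

(** [S] is the union of the [s] heaviest of [j + 1] colour classes; a clique meets each class at
    most once. *)
Lemma ktree_subclique_number k (A : {set T}) j s (V : {set T}) : ktree k A ->
  V \subset A -> s <= j.+1 ->
  (forall K : {set T}, K \subset V -> rel_clique K -> #|K| <= j.+1) ->
  exists S : {set T}, [/\ S \subset V, s * #|V| <= j.+1 * #|S| &
    forall K : {set T}, K \subset S -> rel_clique K -> #|K| <= s].
Proof.
move=> tA VA sj VK; have [f fP] := ktree_coloring tA VK.
have [|J cJ] := @heavy_subset 'I_j.+1 (fun i => #|[set x in V | f x == i]|) s.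
  by rewrite card_ord.
rewrite card_ord => wJ; exists [set x in V | f x \in J]; split.
- by apply/subsetP => x; rewrite inE => /andP[].
- have cV (I : {set 'I_j.+1}) :
      \sum_(i in I) #|[set x in V | f x == i]| = #|[set x in V | f x \in I]|.
    rewrite -sum1_card (partition_big f (mem I)) /=; last first.
      by move=> x; rewrite inE => /andP[].
    apply: eq_bigr => i iI; rewrite -sum1_card; apply: eq_bigl => x.
    by rewrite !inE; case: eqP => [->|]; rewrite ?andbF // iI !andbT.
  move: wJ; rewrite cV; congr (s * _ <= _).
  transitivity (\sum_(i in [set: 'I_j.+1]) #|[set x in V | f x == i]|).
    by apply: eq_bigl => i; rewrite inE.
  by rewrite cV; apply: eq_card => x; rewrite !inE andbT.
- move=> K /subsetP KS clK; rewrite -cJ -(card_in_imset (f := f)).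
    by apply/subset_leq_card/subsetP => _ /imsetP[x /KS + ->]; rewrite inE => /andP[].
  move=> x y xK yK fxy; apply/eqP; apply: contraPT fxy => xy; apply/eqP.
  have F z : z \in K -> z \in A :&: V.
    by move=> /KS; rewrite !inE => /andP[zV _]; rewrite (subsetP VA).
  by apply: fP; [exact: F | exact: F | exact: clK].
Qed.

End Cliques.

(** * Chordal graphs *)

Lemma last_take (T : Type) (x0 x : T) s i : i <= size s ->
  last x (take i s) = nth x0 (x :: s) i.
Proof.
move=> i_s; rewrite (last_nth x0) size_takel //.
by rewrite -(nth_take x0 (ltnSn i) (x :: s)).
Qed.

Section Dirac.
Variable G : sgraph.
Hypothesis chG : chordal G.

(* If [x] and [y] are not adjacent, then a shortest path of this kind closes up
   through [v] to a chordless cycle; a chord shortens the path. *)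
Lemma chordal_neighbours (v x y : G) (s : seq G) :
  adj v x -> adj v y -> x != y -> path adj x s -> last x s = y ->
  {in s, forall z, z != v /\ (adj v z -> z = x \/ z = y)} -> adj x y.
Proof.
move=> vx vy xy; move: {-1}(size s) (leqnn (size s)) => n.
elim: n s => [|n IH] s0 sn ps0 ls0 vs0.
  by case: s0 sn ls0 {ps0 vs0} => //= _ E; rewrite E eqxx in xy.
case: (shortenP ps0) ls0 => s ps us ss0 ls.
have {ps0 vs0} vs : {in s, forall z, z != v /\ (adj v z -> z = x \/ z = y)}.
  by move=> z /ss0; apply: vs0.
have {s0 ss0} sn : size s <= n.+1.
  by apply: leq_trans sn; apply: uniq_leq_size => //; case/andP: us.
have vNx : v != x by apply: contraTneq vx => ->; rewrite adj_irr.
(* If [s] is a single vertex, the path is the desired edge; otherwise the cycle through [v] has at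
   least four vertices. *)
have [s2|] := leqP 2 (size s); last first.
  case: s ps ls {us vs sn} => [_ E|z [|//] /= /andP[xz _] E].
    by rewrite -E eqxx in xy.
  by rewrite -E.
have uc : uniq (v :: x :: s).
  rewrite cons_uniq us andbT inE negb_or vNx /=.
  by apply/negP => /vs [/eqP].
have cyc : ucycle adj (v :: x :: s).
  rewrite /ucycle uc andbT /= vx rcons_path ps ls /=.
  by rewrite adj_sym.
(* The default [v] of [nth] is the right successor of the last vertex. *)
have nextP i : i <= size (x :: s) ->
    next (v :: x :: s) (nth v (v :: x :: s) i) = nth v (x :: s) i.
  by move=> i_s; rewrite next_nth mem_nth // index_uniq.
have [a [b [ac bc ab bna anb]]] := chG (s2 : 4 <= size (v :: x :: s)) cyc.
have [i [j [ij js abij bnext anext]]] : exists i j, [/\ i < j, j <= size (x :: s),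
    adj (nth v (v :: x :: s) i) (nth v (v :: x :: s) j),
    nth v (v :: x :: s) j != nth v (x :: s) i &
    nth v (v :: x :: s) i != nth v (x :: s) j].
  move: ac bc => /(nthP v)[i ic Ei] /(nthP v)[j jc Ej].
  rewrite -Ei -Ej in ab bna anb; rewrite !nextP // in bna anb.
  have [ij|ij|E] := ltngtP i j.
  - by exists i, j.
  - by exists j, i; rewrite adj_sym.
  - by rewrite E adj_irr in ab.
have {bnext} ij1 : i.+1 < j.
  rewrite ltn_neqAle ij andbT; apply: contraNneq bnext => <- //=.
(* A chord at [v] would end in [x] or [y], which are consecutive to [v] on the cycle. *)
case: i ij abij anext ij1 => [|i] ij abij anext ij1.
  case: j ij js abij anext ij1 => [//|j] _ js; rewrite /= => vj anext j_gt0.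
  have [jx|jy] : nth v (x :: s) j = x \/ nth v (x :: s) j = y.
  - have : nth v (x :: s) j \in s.
      by case: j js j_gt0 {vj anext} => //= j js _; apply: mem_nth.
    by case/vs => _; apply.
  - have : nth v (x :: s) j != nth v (x :: s) 0 by rewrite nth_uniq // -lt0n.
    by rewrite jx eqxx.
  - have : nth v (x :: s) j == nth v (x :: s) (size s).
      by rewrite jy -(last_nth v) ls.
    rewrite nth_uniq // => /eqP E; move: anext.
    by rewrite E /= nth_default ?eqxx.
case: j ij js abij anext ij1 => [//|[//|j]] _ js /= pij _ ij1.
have Ed : drop j s = nth v s j :: drop j.+1 s by rewrite -drop_nth.
have {}js : j < size s := js.
have lj : last x (take j.+1 s) = nth v s j by rewrite (last_take v).
have {}ij1 : i < j := ij1.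
have i_s : i <= size s := ltnW (ltn_trans ij1 js).
have li : last x (take i s) = nth v (x :: s) i by rewrite (last_take v).
have /andP[pt pd] : path adj x (take j.+1 s) && path adj (nth v s j) (drop j.+1 s).
  by rewrite -lj -cat_path cat_take_drop.
(* Now both ends of the chord lie on the path; the vertices strictly between them are skipped. *)
apply: (IH (take i s ++ drop j s)).
- rewrite size_cat size_takel // size_drop -ltnS; apply: leq_trans sn.
  by rewrite -{2}(subnKC (ltnW js)) ltn_add2r.
- by rewrite cat_path take_path // li Ed /= pij.
- by rewrite last_cat Ed /= -ls -[s in RHS](cat_take_drop j.+1 s) last_cat lj.
- by move=> z; rewrite mem_cat => /orP[/mem_take|/mem_drop]; apply: vs.
Qed.

(** Avoiding a clique [K] is what makes the induction work. Let [v] be adjacent to the rest of [K]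
    but not to all of [A], let [C] be a component of the non-neighbours of [v] in [A], and [S] the
    neighbours of [v] that have a neighbour in [C]. By [chordal_neighbours], [S] is a clique. A
    vertex of [C] that is simplicial in [C :|: S] is so in [A], and it avoids [K], being
    non-adjacent to [v]. *)
Lemma chordal_simplicial (A K : {set G}) : clique K -> K \proper A ->
  exists2 x, x \in A :\: K & clique (nbrs adj A x).
Proof.
move: {-1}#|A| (leqnn #|A|) => n; elim: n A K => [|n IH] A K An clK KA.
  by move: KA; rewrite properE (cards0_eq (_ : #|A| = 0)) ?sub0set ?andbF //; lia.
have [KsA [w0 w0A w0K]] := properP KA.
pose dom v := [forall w in A, (w != v) ==> adj v w].
have [/existsP[v /and3P[vA vND Kv]]|noV] := boolP
  [exists v, [&& v \in A, ~~ dom v & [forall u in K, (u != v) ==> adj v u]]];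
  last first.
  (* Without such a [v], first the vertices of [K] and then all vertices of [A] are adjacent to all
     others: [A] is a clique. *)
  have domP v : v \in A -> dom v.
    move=> vA; have domK u : u \in K -> dom u.
      move=> uK; apply: contraNT noV => uND; apply/existsP; exists u.
      rewrite (subsetP KsA) // uND; apply/forall_inP => w wK.
      by apply/implyP => wu; apply: clK => //; rewrite eq_sym.
    apply: contraNT noV => vND; apply/existsP; exists v.
    rewrite vA vND; apply/forall_inP => u uK; apply/implyP => uv.
    by have /forall_inP/(_ v vA)/implyP := domK u uK; rewrite eq_sym adj_sym; apply.
  exists w0; first by rewrite inE w0K.
  move=> x y; rewrite !inE => /andP[xA _] /andP[yA _] xy.
  by have /forall_inP/(_ y yA)/implyP := domP x xA; rewrite eq_sym; apply.
have /forall_inPn[w wA] := vND; rewrite negb_imply => /andP[wv vw].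
pose U := [set u in A | (u != v) && ~~ adj v u].
pose r := [rel a b | [&& a \in U, b \in U & adj a b]].
pose C := [set u | connect r w u].
pose S := [set s in A | adj v s && [exists c in C, adj s c]].
have wU : w \in U by rewrite inE wA wv.
have CU c : c \in C -> c \in U.
  rewrite inE => /connectP[p]; case/lastP: p => [_ -> //|p z].
  by rewrite rcons_path last_rcons => /andP[_ /and3P[_ zU _]] ->.
have r_sym : connect_sym r.
  by apply: sym_connect_sym => a b /=; rewrite adj_sym andbCA.
have clS : clique S.
  move=> s1 s2; rewrite !inE => /and3P[_ vs1 /exists_inP[c1 c1C sc1]].
  move=> /and3P[_ vs2 /exists_inP[c2 c2C sc2]] s12.
  have : connect r c1 c2.
    by move: c1C c2C; rewrite !inE r_sym; apply: connect_trans.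
  case/connectP => p rp c2p.
  have pC z : z \in c1 :: p -> z \in U.
    move=> zp; apply: CU; rewrite inE; move: c1C; rewrite inE => /connect_trans.
    by apply; apply: path_connect zp.
  apply: (@chordal_neighbours v s1 s2 (c1 :: rcons p s2)) => //.
  - rewrite /= sc1 rcons_path -c2p adj_sym sc2 andbT.
    by apply: sub_path rp => a b /and3P[].
  - by rewrite /= last_rcons.
  - move=> z; rewrite -rcons_cons mem_rcons inE => /orP[/eqP->|/pC].
      by split; [apply: contraTneq vs2 => ->; rewrite adj_irr | right].
    by rewrite inE => /and3P[_ zv /negPf->].
have SC : S \proper C :|: S.
  apply/properP; split; first exact: subsetUr.
  by exists w; rewrite !inE ?connect0 // (negPf vw) andbF.
have [|x] := IH (C :|: S) S _ clS SC.
  rewrite -ltnS; apply: leq_trans An; apply: proper_card; apply/properP; split.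
    apply/subsetP => z; rewrite inE => /orP[/CU|]; by rewrite inE => /andP[].
  exists v => //; rewrite inE negb_or; apply/andP; split.
    by apply/negP => /CU; rewrite inE eqxx andbF.
  by rewrite inE adj_irr andbF.
rewrite inE => /andP[xS]; rewrite inE (negPf xS) orbF => xC clx.
have xU := CU x xC.
have [xA xv vx] : [/\ x \in A, x != v & ~~ adj v x].
  by move: xU; rewrite inE => /and3P[].
exists x.
  rewrite inE xA andbT; apply/negP => xK.
  by have /forall_inP/(_ x xK)/implyP/(_ xv) := Kv; apply/negP.
apply: sub_rel_clique clx; apply/subsetP => u; rewrite inE => /andP[uA xu].
rewrite inE xu andbT inE; have [vu|vu] := boolP (adj v u).
  apply/orP; right; rewrite inE uA vu; apply/exists_inP; exists x => //.
  by rewrite adj_sym.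
apply/orP; left; rewrite inE; move: (xC); rewrite inE => /connect_trans; apply.
apply: connect1; rewrite /= xU xu inE uA vu !andbT.
by apply: contraNneq vx => <-; rewrite adj_sym.
Qed.

End Dirac.

(** * Passing between chordal graphs and [k]-trees *)

Lemma eq_ktree (T : finType) (e1 e2 : rel T) k (A : {set T}) :
  {in A &, e1 =2 e2} -> ktree e1 k A -> ktree e2 k A.
Proof.
move=> + tA; elim: tA => [B cB clB|B v _ IH vB clN cN] e12.
  by apply: ktree_base => // x y xB yB; rewrite -e12 //; apply: clB.
have BvB : {subset B <= v |: B} by apply/subsetP; apply: subsetU1.
have EN : nbrs e2 B v = nbrs e1 B v.
  apply/setP => u; rewrite !inE; apply: andb_id2l => uB.
  by rewrite e12 ?setU11 ?BvB.
apply: ktree_step; rewrite ?EN //.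
  by apply: IH => x y xB yB; rewrite e12 ?BvB.
have NB x : x \in nbrs e1 B v -> x \in v |: B.
  by rewrite inE => /andP[/BvB].
by move=> x y xN yN xy; rewrite -e12 ?NB //; apply: clN.
Qed.

(** A simplicial vertex [x] is removed and the rest embedded by induction. The neighbours of [x] are
    a clique on at most [k] vertices, which is extended to a clique [K] on exactly [k]. *)
Lemma chordal_ktree (G : sgraph) k (A : {set G}) : chordal G ->
  (forall K : {set G}, clique K -> #|K| <= k.+1) -> k < #|A| ->
  exists e : rel G, [/\ symmetric e, irreflexive e, ktree e k A &
    {in A &, forall x y, adj x y -> e x y}].
Proof.
move=> chG clG; move En : (#|A| - k.+1) => n; elim: n A En => [|n IH] A An kA.
  exists [rel x y | x != y]; split=> [x y|x||x y _ _ xy] /=.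
  - by rewrite eq_sym.
  - by rewrite eqxx.
  - by apply: ktree_base => //; lia.
  - by apply: contraTneq xy => ->; rewrite adj_irr.
have [x] : exists2 x, x \in A :\: set0 & clique (nbrs adj A x).
  apply: chordal_simplicial => //; first by move=> a b; rewrite inE.
  by rewrite proper0 -card_gt0; lia.
rewrite setD0 => xA clx; have cA := cardsD1 x A; rewrite xA in cA.
have [||e [e_sym e_irr te ae]] := IH (A :\ x); try by lia.
have NA : nbrs adj A x \subset A :\ x.
  apply/subsetP => u; rewrite !inE => /andP[-> xu].
  by rewrite andbT; apply: contraTneq xu => ->; rewrite adj_irr.
have xN : x \notin nbrs adj A x by rewrite inE adj_irr andbF.
have [||K [NK KA clK cK]] := ktree_clique_extend e_sym te NA.
- move=> a b aN bN ab; apply: ae; rewrite ?(subsetP NA) //; exact: clx.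
- have := clG (x |: nbrs adj A x); rewrite cardsU1 xN; apply.
  apply: rel_cliqueU1 => //; first exact: adj_sym.
  by move=> u; rewrite inE => /andP[].
have xK : x \notin K by apply/negP => /(subsetP KA); rewrite !inE eqxx.
(* The relation [e] with the neighbourhood of [x] replaced by [K]. *)
pose e' := [rel a b | if a == x then b \in K else if b == x then a \in K else e a b].
exists e'; split.
- by move=> a b /=; case: (eqVneq a x) => [->|_]; case: (eqVneq b x) => [E|_] //; rewrite E.
- by move=> a /=; have [->|ax] := eqVneq a x; [apply/negbTE | apply: e_irr].
- have EN : nbrs e' (A :\ x) x = K.
    apply/setP => u; rewrite !inE /= eqxx andbC; apply: andb_idr => uK.
    by have := subsetP KA u uK; rewrite !inE.
  have e'e : {in A :\ x &, e =2 e'}.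
    by move=> a b; rewrite !inE /= => /andP[/negPf-> _] /andP[/negPf-> _].
  rewrite -(setD1K xA); apply: ktree_step; rewrite ?EN ?setD11 //.
    exact: eq_ktree te.
  move=> a b aK bK ab; rewrite -e'e ?(subsetP KA) //; exact: clK.
- move=> a b aA bA /=; have [Ea|ax] := eqVneq a x; last have [Eb|bx] := eqVneq b x.
  + by move=> ab; apply: (subsetP NK); rewrite inE bA -Ea.
  + by move=> ab; apply: (subsetP NK); rewrite inE aA adj_sym -Eb.
  + by apply: ae; rewrite !inE ?ax ?bx.
Qed.

(** The last vertex added that lies on the cycle has both its cycle neighbours in a clique; they
    span a chord. *)
Lemma ktree_chordal (G : sgraph) k : ktree (@adj G) k [set: G] -> chordal G.
Proof.
move=> tG c sc cyc; have : {subset c <= [set: G]} by move=> x; rewrite inE.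
have [cc uc] := andP cyc.
have clique_chord (B : {set G}) x : x \in c -> clique B -> next c x \in B ->
    prev c x \in B -> exists x y : G, [/\ x \in c, y \in c, adj x y,
      y != next c x & x != next c y].
  move=> xc clB nB pB; apply: (chord_of_neighbours sc cyc xc); apply: clB => //.
  have [_ + _] := iter_next_neq sc uc xc.
  by apply: contraNneq => ->; rewrite next_prev.
elim: tG => [B _ clB cB|B v tB IH vB clN _ cB].
  have [x xc] : exists x, x \in c by case: c sc {cyc cc uc cB clique_chord} => // x *; exists x; rewrite mem_head.
  by apply: (clique_chord B x) => //; apply: cB; rewrite ?mem_next ?mem_prev.
have [vc|vc] := boolP (v \in c); last first.
  apply: IH => x xc; have := cB x xc; rewrite !inE => /orP[/eqP E|//].
  by rewrite E in xc; rewrite xc in vc.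
have inN x : x \in c -> adj v x -> x \in nbrs adj B v.
  move=> xc vx; have := cB x xc; rewrite !inE vx andbT => /orP[/eqP E|//].
  by rewrite E adj_irr in vx.
apply: (clique_chord _ v vc clN); apply: inN; rewrite ?mem_next ?mem_prev //.
  exact: next_cycle.
by rewrite adj_sym prev_cycle.
Qed.

(** Used both for induced subgraphs and to cut a chordal supergraph down to the vertices of [G]. *)
Lemma chordal_pullback (G H : sgraph) (f : G -> H) : injective f ->
  (forall x y, adj (f x) (f y) = adj x y) -> chordal H -> chordal G.
Proof.
move=> f_inj fE chH c sc /andP[cyc uc].
have [||_ [_ [/mapP[x xc ->] /mapP[y yc ->]]]] := chH (map f c).
- by rewrite size_map.
- rewrite /ucycle map_inj_uniq // uc andbT cycle_map.
  by apply: sub_cycle cyc => a b /=; rewrite fE.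
- rewrite !next_map // !(inj_eq f_inj) fE => xy nx ny.
  by exists x, y.
Qed.

Lemma treewidth_le (G H : sgraph) t : chordal H -> subgraph G H ->
  (forall K : {set H}, clique K -> #|K| <= t.+1) -> treewidth G <= t.
Proof.
move=> chH GH clH.
by apply: (proj2 (@leastP _ t _)); exists H.
Qed.

(** * Treewidth and the degree count *)

Section Complete.
Variables (T : finType) (B : {set T}).

(** Vertices outside [B] stay isolated, so that a graph of treewidth [k] exists on any number
    [n > k] of vertices. *)
Definition complete_adj : rel T := [rel x y | [&& x \in B, y \in B & x != y]].

Lemma complete_sym : symmetric complete_adj.
Proof. by move=> x y; rewrite /complete_adj /= eq_sym andbCA. Qed.

Lemma complete_irr : irreflexive complete_adj.
Proof. by move=> x; rewrite /complete_adj /= eqxx !andbF. Qed.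

Definition complete_on : sgraph := SGraph complete_sym complete_irr.

Lemma complete_on_clique : clique (B : {set complete_on}).
Proof. by move=> x y xB yB xy; rewrite /= /complete_adj /= xB yB. Qed.

Lemma complete_on_chordal : chordal complete_on.
Proof.
move=> c sc cyc; have [cc uc] := andP cyc.
have [x xc] : exists x, x \in c.
  by case: c sc {cyc cc uc} => // x *; exists x; rewrite mem_head.
apply: (chord_of_neighbours sc cyc xc).
have /and3P[_ nB _] := next_cycle cc xc.
have /and3P[pB _ _] := prev_cycle cc xc.
apply: complete_on_clique => //; have [_ + _] := iter_next_neq sc uc xc.
by apply: contraNneq => ->; rewrite next_prev.
Qed.

Lemma complete_on_clique_card k (K : {set complete_on}) :
  #|B| <= k.+1 -> clique K -> #|K| <= k.+1.
Proof.
(* A clique on one vertex need not lie in [B]. *)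
move=> Bk clK; have [K1|K1] := leqP #|K| 1; first exact: leq_trans K1 _.
apply: leq_trans Bk; apply/subset_leq_card/subsetP => x xK.
have /card_gt0P[y] : 0 < #|K :\ x| by have := cardsD1 x K; rewrite xK; lia.
by rewrite !inE => /andP[yx yK]; have /and3P[] := clK y x yK xK yx.
Qed.
End Complete.

Lemma treewidthP (G : sgraph) : exists H : sgraph,
  [/\ chordal H, subgraph G H &
      forall K : {set H}, clique K -> #|K| <= (treewidth G).+1].
Proof.
pose P k := exists H : sgraph,
    [/\ chordal H, subgraph G H & forall K : {set H}, clique K -> #|K| <= k.+1].
apply: (proj1 (@leastP P #|G| _)); exists (complete_on [set: G]); split.
- exact: complete_on_chordal.
- exists id => // x y xy; rewrite /= /complete_adj /= !inE.
  by apply: contraTneq xy => ->; rewrite adj_irr.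
- by move=> K; apply: complete_on_clique_card; rewrite cardsT.
Qed.

(** For the lower bound, the image of [B] is a clique in every graph containing [complete_on B]. *)
Lemma treewidth_complete_on (T : finType) (B : {set T}) k :
  #|B| = k.+1 -> treewidth (complete_on B) = k.
Proof.
move=> Bk; apply/eqP; rewrite eqn_leq; apply/andP; split.
  apply: (treewidth_le (H := complete_on B)).
  - exact: complete_on_chordal.
  - by exists id.
  - by move=> K; apply: complete_on_clique_card; rewrite Bk.
have [H [_ [f f_inj fP] clH]] := treewidthP (complete_on B).
have := clH (f @: B); rewrite card_imset // Bk ltnS; apply.
move=> _ _ /imsetP[x xB ->] /imsetP[y yB ->] fxy; apply: fP.
by apply: complete_on_clique => //; apply: contraNneq fxy => ->.
Qed.

Lemma treewidth_ktree (G : sgraph) k : treewidth G <= k -> k < #|G| ->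
  exists e : rel G, [/\ symmetric e, irreflexive e, ktree e k [set: G] &
    forall x y, adj x y -> e x y].
Proof.
move=> twG kG; have [H [chH [f f_inj fP] clH]] := treewidthP G.
have psym : symmetric [rel x y : G | adj (f x) (f y)].
  by move=> x y /=; rewrite adj_sym.
have pirr : irreflexive [rel x y : G | adj (f x) (f y)].
  by move=> x /=; rewrite adj_irr.
pose P := SGraph psym pirr.
have chP : chordal P by apply: (chordal_pullback (f := f : P -> H)).
have [||e [esym eirr te eP]] := chordal_ktree (k := k) (A := [set: P]) chP.
- move=> K clK; rewrite -(card_imset _ f_inj); apply: leq_trans (clH _ _) _ => //.
  move=> _ _ /imsetP[x xB ->] /imsetP[y yB ->] fxy; apply: clK => //.
  by apply: contraNneq fxy => ->.
- by rewrite cardsT.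
- by exists e; split=> // x y xy; apply: eP; rewrite ?inE //; apply: fP.
Qed.

(* Degrees and cliques are measured in the [k]-tree [e], which contains [G]. *)
Lemma alpha_ktree (G : sgraph) (e : rel G) k t j d (V : {set G}) :
  symmetric e -> irreflexive e -> ktree e k [set: G] ->
  (forall x y, adj x y -> e x y) ->
  {in V, forall v, #|nbrs e [set: G] v| <= d} ->
  (forall K : {set G}, K \subset V -> rel_clique e K -> #|K| <= j.+1) ->
  t.+1 * #|V| <= maxn t.+1 j.+1 * alpha t d G.
Proof.
move=> esym eirr te Ge Vd Vj.
have [|S [SV cS clS]] := @ktree_subclique_number _ _ esym eirr _ _ j
  (minn t.+1 j.+1) V te (subsetT V) _ Vj; first exact: geq_minr.
have Sa : #|S| <= alpha t d G.
  rewrite /alpha; apply: (@leq_bigmax_cond _ _ (fun S : {set G} => #|S|)).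
  apply/andP; split.
    apply/forall_inP => v vS; apply: leq_trans (Vd v (subsetP SV v vS)).
    rewrite /degree; apply/subset_leq_card/subsetP => u; rewrite !inE.
    exact: Ge.
  (* The chordal witness is the subgraph of the [k]-tree induced on [S]. *)
  pose E := SGraph esym eirr.
  apply: (treewidth_le (H := induced (S : {set E}))).
  - apply: (@chordal_pullback (induced (S : {set E})) E val) => //.
      exact: val_inj.
    exact: (@ktree_chordal E k te).
  - by exists id => // x y; apply: Ge.
  - move=> K clK; rewrite -(card_imset _ val_inj).
    apply: leq_trans (clS _ _ _) (geq_minl _ _).
      by apply/subsetP => _ /imsetP[x _ ->]; apply: valP.
    by move=> _ _ /imsetP[x xK ->] /imsetP[y yK ->] xy; apply: clK.
(* If [t > j], all colour classes are taken and the bound is [#|V| <= #|S|]. *)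
have [tj|jt] := leqP t j.
  rewrite (minn_idPl _) // in cS; rewrite (maxn_idPr _) //.
  exact: leq_trans cS (leq_mul (leqnn _) Sa).
have jt1 : j.+1 <= t.+1 by apply: ltnW.
rewrite (minn_idPr jt1) leq_pmul2l // in cS; rewrite (maxn_idPl jt1) leq_pmul2l //.
exact: leq_trans cS Sa.
Qed.

(** The first [t] terms are [t + 1], the others run from [t + 1] to [k]. This is the source of
    [t (t + 1)] in the denominator of the theorem. *)
Lemma sum_maxn_succ t k : t <= k ->
  2 * \sum_(j < k) maxn t.+1 j.+1 = k * k.+1 + t * t.+1.
Proof.
elim: k => [|k IH]; first by rewrite leqn0 => /eqP->; rewrite big_ord0.
rewrite leq_eqVlt => /orP[/eqP->|tk].
  rewrite (eq_bigr (fun=> k.+2)); first by rewrite sum_nat_const card_ord; lia.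
  by move=> i _; apply/maxn_idPl; rewrite ltnS ltnW.
rewrite big_ord_recr /= mulnDr IH // (maxn_idPr _) //; lia.
Qed.

(* [2 t.+1] times the degree count [count] below, with [a := alpha t d G] and
   all negative terms moved to the other side. *)
Lemma alpha_bound (G : sgraph) t k d : treewidth G <= k -> t <= k ->
  2 * k <= d -> 2 * k < #|G| ->
  2 * t.+1 * (d.+1 * #|G| + k * k.+1) <=
  2 * t.+1 * (2 * k * #|G|) +
  (2 * k.+1 * (d.+1 - 2 * k) + k * k.+1 + t * t.+1) * alpha t d G.
Proof.
move=> twG tk kd kG; have kG' : k < #|G| by lia.
have [e [esym eirr te Ge]] := treewidth_ktree twG kG'.
pose deg v := #|nbrs e [set: G] v|; set a := alpha t d G.
have degk v : k <= deg v.
  have := @ktree_clique_degree _ _ esym eirr _ _ te [set v] (subsetT _).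
  rewrite cards1 cardsT addn1 => -[|//|//|q].
    by move=> x y; rewrite !inE => /eqP-> /eqP->; rewrite eqxx.
  by rewrite inE => /eqP->.
have boundL : t.+1 * #|[set v | deg v <= d]| <= k.+1 * a.
  rewrite -[k.+1](maxn_idPr (_ : t.+1 <= _)) //.
  apply: (@alpha_ktree _ e k) => // [v|K _]; first by rewrite inE.
  exact: (ktree_clique_card te (subsetT K)).
have boundV (j : 'I_k) :
    t.+1 * #|[set v | deg v <= k + j]| <= maxn t.+1 j.+1 * a.
  apply: (@alpha_ktree _ e k) => // [v|K KV clK].
    by rewrite inE => /leq_trans; apply; have := ltn_ord j; lia.
  (* A larger clique is cut down to exactly [j + 2] vertices; as [j < k], [k + (j + 2) <= 2 * k + 1]
     is at most the order of [G]. *)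
  rewrite leqNgt; apply/negP => jK.
  have [C [_ CK cC]] := @card_sandwich _ set0 K j.+2 (sub0set _)
    (ltac:(by rewrite cards0)) jK.
  have := @ktree_clique_degree _ _ esym eirr _ _ te C (subsetT _)
    (sub_rel_clique CK clK).
  rewrite cC cardsT => -[//||q qC].
    by have := ltn_ord j; lia.
  have := subsetP KV q (subsetP CK q qC); rewrite inE /deg; lia.
(* A vertex of degree [D <= d] contributes at least [(2k - D) + (d + 1 - 2k) + D]; one of larger
   degree contributes enough by [D] alone. *)
have count : d.+1 * #|G| <= \sum_(j < k) #|[set v | deg v <= k + j]| +
    (d.+1 - 2 * k) * #|[set v | deg v <= d]| + \sum_v deg v.
  have cardE (P : pred G) : #|[set v | P v]| = \sum_v P v.
    by rewrite -sum1_card [LHS]big_mkcond; apply: eq_bigr => v _; rewrite inE; case: (P v).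
  rewrite (cardE (fun v => deg v <= d)) big_distrr /=.
  rewrite (eq_bigr (fun j : 'I_k => \sum_v (deg v <= k + j : nat))); last first.
    by move=> j _; rewrite (cardE (fun v => deg v <= k + j)).
  rewrite exchange_big /=.
  rewrite -!big_split mulnC -sum_nat_const; apply: leq_sum => v _ /=.
  (* The base case is the minimum degree [degk]. *)
  have W m : k + m - deg v <= \sum_(j < m) (deg v <= k + j : nat).
    elim: m => [|m IH]; first by rewrite big_ord0 addn0 leqn0 subn_eq0.
    rewrite big_ord_recr; apply: leq_trans (leq_add IH (leqnn _)) => /=.
    by have [h|h] := leqP (deg v) (k + m); lia.
  move: (W k) kd; move: (deg v) (\sum_(j < k) _) => D X.
  by have [h|h] := leqP D d; lia.
have total : \sum_v deg v + k * k.+1 = 2 * k * #|G|.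
  rewrite -cardsT -(ktree_sum_degree esym eirr te); congr (_ + _).
  by apply: eq_bigl => v; rewrite inE.
have sumV : t.+1 * (2 * \sum_(j < k) #|[set v | deg v <= k + j]|) <=
    (k * k.+1 + t * t.+1) * a.
  rewrite mulnCA -(sum_maxn_succ tk) -mulnA leq_pmul2l //.
  by rewrite big_distrr big_distrl; apply: leq_sum => j _; apply: boundV.
move: (\sum_(j < k) _) (\sum_v _) (#|[set v | _]|) count total sumV boundL.
move=> W D L count total sumV boundL.
have := leq_mul (leqnn (2 * (d.+1 - 2 * k))) boundL.
have : 2 * t.+1 * (d.+1 * #|G| + k * k.+1) <=
    2 * t.+1 * (W + (d.+1 - 2 * k) * L + 2 * k * #|G|).
  by rewrite leq_pmul2l // -total addnA leq_add2r.
move: sumV {boundL boundV}; move: (d.+1 - _) (d.+1 * #|G|) (2 * k * #|G|) a => c x y b.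
by clear; nia.
Qed.

(** * The bound for the family, over the rationals *)

Import Order.TTheory GRing.Theory Num.Theory.
Local Open Scope ring_scope.

Theorem theorem5 (t k d n : nat) (htk : (t <= k)%N) (hd : (2 * k <= d)%N)
    (hn : (2 * k + 1 <= n)%N) :
  (alpha_family t d (tw_family n k))%:R >=
    ((d%:R - 2 * k%:R + 1)
       / (d%:R - 3 / 2 * k%:R + 1 + t%:R * (t%:R + 1) / (2 * (k%:R + 1))))
      * ((t%:R + 1) / (k%:R + 1)) * n%:R
    + (k%:R * (t%:R + 1))
       / (d%:R - 3 / 2 * k%:R + 1 + t%:R * (t%:R + 1) / (2 * (k%:R + 1)))
  :> rat.
Proof.
(* The family is nonempty, so [least] is attained by some [G] and is not the default value 0. *)
have [G [Gn Gk] <-] : exists2 G, tw_family n k G &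
    alpha t d G = alpha_family t d (tw_family n k).
  have kn : (k < n)%N by lia.
  pose B : {set 'I_n} := [set i : 'I_n | (i <= k)%N].
  have cB : #|B| = k.+1.
    have -> : B = [set widen_ord kn i | i in [set: 'I_k.+1]].
      apply/setP => i; rewrite inE; apply/idP/imsetP => [ik|[j _ ->]].
        by exists (Ordinal (ik : i < k.+1)%N) => //; apply: val_inj.
      exact: (leq_ord j).
    rewrite card_imset ?cardsT ?card_ord // => i j /(congr1 val) ij.
    exact: val_inj.
  apply: (proj1 (@leastP (fun m => exists2 G, tw_family n k G & alpha t d G = m)
    (alpha t d (complete_on B)) _)).
  exists (complete_on B) => //; split; first by rewrite card_ord.
  exact: treewidth_complete_on.
have := @alpha_bound G t k d; rewrite Gk Gn leqnn => /(_ isT htk hd).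
have kn : (2 * k < n)%N by lia.
move=> /(_ kn) {kn}.
move: (alpha t d G) => a.
rewrite -(ler_nat rat) !(natrD, natrM) natrB; last by lia.
rewrite !(natrM, =^~ natr1).
have: (2 * k)%:R <= d%:R :> rat by rewrite ler_nat.
rewrite natrM.
have: t%:R <= k%:R :> rat by rewrite ler_nat.
have: 0 <= t%:R :> rat by rewrite ler0n.
move: (t%:R) (k%:R) (d%:R) (n%:R) (a%:R) => {htk hd hn Gn Gk}T K D N A T0 TK KD main.
have K1 : 0 < K + 1 by lra.
set E := D - 3 / 2 * K + 1 + T * (T + 1) / (2 * (K + 1)).
(* Thus [2 * (K + 1) * E] is the coefficient of [alpha t d G] in [alpha_bound]. *)
have EK : 2 * (K + 1) * E = 2 * (K + 1) * (D + 1 - 2 * K) + K * (K + 1) + T * (T + 1).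
  rewrite /E; field; lra.
have E0 : 0 < E.
  by rewrite -(pmulr_rgt0 _ (_ : 0 < 2 * (K + 1))) ?EK; nra.
rewrite -(ler_pM2l (_ : 0 < 2 * (K + 1) * E)); last by nra.
have -> : 2 * (K + 1) * E * ((D - 2 * K + 1) / E * ((T + 1) / (K + 1)) * N + K * (T + 1) / E)
   = 2 * (T + 1) * ((D - 2 * K + 1) * N + K * (K + 1)).
  by field; rewrite !gt_eqF.
rewrite EK; nra.
Qed.
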